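(* The following structures determine each other ''up-to-isomorphism'' (and hence they can be considered equivalent): (i) Rough sets induced by quasiorders; (ii) Nelson algebras defined on algebraic lattices; (iii) Nelson algebras defined on $\mathrm{T}_0$-spaces that are Alexandrov topologies; (iv) Monteiro spaces.
   Context: Nelson algebras. A Nelson algebra is a structure $\mathbb{A}=(A,\vee,\wedge,\rightarrow,{\sim},0,1)$ such that $(A,\vee,\wedge,0,1)$ is a bounded distributive lattice and for all $a,b,c\in A$: (N1) ${\sim}{\sim}a=a$; (N2) $a\le b$ if and only if ${\sim}b\le{\sim}a$; (N3) $a\wedge{\sim}a\le b\vee{\sim}b$; (N4) $a\wedge c\le({\sim}a)\vee b$ if and only if $c\le a\rightarrow b$; (N5) $(a\wedge b)\rightarrow c=a\rightarrow(b\rightarrow c)$. An algebraic lattice is a complete lattice in which every element is a join of compact elements. A Nelson algebra is defined on an algebraic lattice if its underlying lattice is algebraic. Rough sets. A quasiorder on a set $U$ is a reflexive transitive binary relation $R$ on $U$. For $x\in U$ put $R(x)=\{y\in U\mid x\,R\,y\}$; for $X\subseteq U$ put $X^{\blacktriangledown}=\{x\in U\mid R(x)\subseteq X\}$, $X^{\blacktriangle}=\{x\in U\mid R(x)\cap X\ne\emptyset\}$ and $-X=U\setminus X$. The rough sets induced by $R$ are the elements of $\mathit{RS}=\{(X^{\blacktriangledown},X^{\blacktriangle})\mid X\subseteq U\}$, ordered by coordinatewise inclusion. They form a Nelson algebra $\mathbb{RS}$ with $0=(\emptyset,\emptyset)$, $1=(U,U)$, $\vee$ and $\wedge$ being coordinatewise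 union and intersection, ${\sim}(X^{\blacktriangledown},X^{\blacktriangle})=(-X^{\blacktriangle},-X^{\blacktriangledown})$, and $(X^{\blacktriangledown},X^{\blacktriangle})\rightarrow(Y^{\blacktriangledown},Y^{\blacktriangle})=\big((-X^{\blacktriangledown}\cup Y^{\blacktriangledown})^{\blacktriangledown},\,-X^{\blacktriangledown}\cup Y^{\blacktriangle}\big)$. Alexandrov topologies. An Alexandrov topology on a set is a topology (identified with its family $\mathcal{T}$ of open sets, which is a lattice under inclusion) in which arbitrary intersections of open sets are open. It is a $\mathrm{T}_0$-space if for any two different points there is an open set containing one of them and not the other. Monteiro spaces. A Monteiro space is a structure $\mathcal{M}=(X,\le,g)$ where $(X,\le)$ is a partially ordered set and $g$ is a map on $X$ satisfying for all $x,y\in X$: (J1) if $x\le y$, then $g(y)\le g(x)$; (J2) $g(g(x))=x$; (J3) $x\le g(x)$ or $g(x)\le x$; (J4) if $x,y\le g(x),g(y)$ (each of $x,y$ is below each of $g(x),g(y)$), then there is $z\in X$ such that $x,y\le z\le g(x),g(y)$. From Monteiro spaces to Nelson algebras. A Monteiro space $\mathcal{M}=(X,\le,g)$ induces the Nelson algebra $\mathbb{N}_{\mathcal{M}}=(\mathcal{U}(X),\cup,\cap,\rightarrow,{\sim},\emptyset,X)$, where $\mathcal{U}(X)$ is the set of upsets of $(X,\le)$ (which is an Alexandrov topology and a $\mathrm{T}_0$-space), ${\sim}B=\{x\in X\mid g(x)\notin B\}$ and $B\rightarrow C=\{x\in X\mid\text{for all }y\in X,\ x\le y\text{ and }y\in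 B\text{ imply }y\in({\sim}B)\cup C\}$. From Nelson algebras to Monteiro spaces. A Nelson algebra $\mathbb{A}$ defined on an algebraic lattice induces the Monteiro space $(\mathcal{J},\triangleleft,g)$, where $\mathcal{J}$ is the set of completely join-irreducible elements of $A$ ($j$ is completely join-irreducible if $j=\bigvee S$ implies $j\in S$ for every $S\subseteq A$), $x\triangleleft y\iff y\le x$ in $A$ for $x,y\in\mathcal{J}$, and $g(j)=\bigwedge\{x\in A\mid x\nleq{\sim}j\}$ for $j\in\mathcal{J}$. Sense of ''determine each other''. The equivalence of (i), (ii) and (iii) is meant in the sense that each Nelson algebra defined on an algebraic lattice can be represented up to isomorphism as (i) and as (iii). The equivalence of (ii) and (iv) is meant in the sense that each Monteiro space induces a Nelson algebra defined on an algebraic lattice, and each Nelson algebra defined on an algebraic lattice induces a Monteiro space that determines an Alexandrov topology Nelson algebra isomorphic to the original algebra. *)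

(* Defs.v *)
From HB Require Import structures.
From Corelib Require Import RelationClasses.
From mathcomp Require Import all_boot all_order.
From mathcomp Require Import mathcomp_extra boolp classical_sets functions.
From mathcomp Require Import cardinality topology.

Set Implicit Arguments.
Unset Strict Implicit.
Unset Printing Implicit Defensive.

Import Order.TTheory.
Local Open Scope classical_set_scope.
Local Open Scope order_scope.

HB.mixin Record TBDistrLattice_isNelson (d : Order.disp_t) A
    of Order.TBDistrLattice d A := {
  nimp : A -> A -> A;
  nneg : A -> A;
  nnegK : forall a : A, nneg (nneg a) = a;
  nneg_anti : forall a b : A, (a <= b) = (nneg b <= nneg a);
  nneg_kleene : forall a b : A, a `&` nneg a <= b `|` nneg b;
  nimp_adj : forall a b c : A, (a `&` c <= nneg a `|` b) = (c <= nimp a b);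
  nimp_curry : forall a b c : A, nimp (a `&` b) c = nimp a (nimp b c)
}.

#[short(type="nelsonType")]
HB.structure Definition Nelson (d : Order.disp_t) :=
  {A of TBDistrLattice_isNelson d A & Order.TBDistrLattice d A}.

Section AlgebraicLattice.
Context {d : Order.disp_t} (L : latticeType d).
Implicit Types (S F : set L) (a : L).

Definition complete_lattice : Prop :=
  forall S, supremums S !=set0 /\ infimums S !=set0.

Definition compact_element a : Prop :=
  forall S s, supremums S s -> a <= s ->
  exists F, [/\ finite_set F, F `<=` S & exists2 t, supremums F t & a <= t].

Definition algebraic_lattice : Prop :=
  complete_lattice /\
  forall a, exists2 S, S `<=` [set c | compact_element c] & supremums S a.

(* The case [S = set0] excludes the least element. *)
Definition completely_join_irreducible : set L :=
  [set j | forall S, supremums S j -> S j].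

End AlgebraicLattice.

Arguments completely_join_irreducible {d} L.

(* Concrete algebras of sets (or of pairs of sets).  The operations are given
   by formulas that make sense on the whole ambient type [T], but the algebra
   meant is their restriction to [carrier].  That this restriction is well
   defined (i.e. that [carrier] is closed under the operations) and is a Nelson
   algebra is not part of the record: it is what [is_nelson] asserts. *)
Record set_algebra (T : Type) := SetAlgebra {
  carrier : set T;
  sjoin : T -> T -> T;
  smeet : T -> T -> T;
  simp : T -> T -> T;
  sneg : T -> T;
  sbot : T;
  stop : T
}.

Record nelson_iso {d : Order.disp_t} (A : nelsonType d) (T : Type)
    (B : set_algebra T) (f : A -> T) : Prop := {
  iso_bij : set_bij [set: A] (carrier B) f;
  iso_join : forall a b, f (a `|` b) = sjoin B (f a) (f b);
  iso_meet : forall a b, f (a `&` b) = smeet B (f a) (f b);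
  iso_imp : forall a b, f (nimp a b) = simp B (f a) (f b);
  iso_neg : forall a, f (nneg a) = sneg B (f a);
  iso_bot : f \bot = sbot B;
  iso_top : f \top = stop B
}.

Definition isomorphic {d : Order.disp_t} (A : nelsonType d) (T : Type)
    (B : set_algebra T) : Prop :=
  exists f : A -> T, nelson_iso B f.

Definition is_nelson (T : Type) (B : set_algebra T) : Prop :=
  exists (d : Order.disp_t) (A : nelsonType d), isomorphic A B.

Definition is_algebraic_nelson (T : Type) (B : set_algebra T) : Prop :=
  exists (d : Order.disp_t) (A : nelsonType d),
    algebraic_lattice A /\ isomorphic A B.

Section RoughSets.
Variables (U : Type) (R : U -> U -> Prop).
Implicit Types (X : set U) (p q : set U * set U).

Definition lower_approx X : set U := [set x | [set y | R x y] `<=` X].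
Definition upper_approx X : set U := [set x | [set y | R x y] `&` X !=set0].

Definition rough_sets : set (set U * set U) :=
  range (fun X => (lower_approx X, upper_approx X)).

Definition rough_set_algebra : set_algebra (set U * set U) := {|
  carrier := rough_sets;
  sjoin := fun p q => (p.1 `|` q.1, p.2 `|` q.2)%classic;
  smeet := fun p q => (p.1 `&` q.1, p.2 `&` q.2)%classic;
  simp := fun p q =>
    (lower_approx (~` p.1 `|` q.1), ~` p.1 `|` q.2)%classic;
  sneg := fun p => (~` p.2, ~` p.1)%classic;
  sbot := (set0, set0);
  stop := (setT, setT)
|}.

End RoughSets.

Definition alexandrov_space (X : topologicalType) : Prop :=
  forall F : set (set X), F `<=` open -> open (\bigcap_(B in F) B).

(* The lattice of open sets with a given implication and negation.  It has
   unions and binary intersections as operations since open sets are ordered by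
   inclusion; [imp] and [neg] matter only on open sets. *)
Definition open_algebra (X : topologicalType)
    (imp : set X -> set X -> set X) (neg : set X -> set X) :
    set_algebra (set X) := {|
  carrier := open;
  sjoin := setU;
  smeet := setI;
  simp := imp;
  sneg := neg;
  sbot := set0;
  stop := setT
|}.

Record monteiro {d : Order.disp_t} (X : porderType d) (g : X -> X) : Prop := {
  monteiro_anti : forall x y, x <= y -> g y <= g x;
  monteiroK : forall x, g (g x) = x;
  monteiro_cmp : forall x, x <= g x \/ g x <= x;
  monteiro_interp : forall x y,
    [/\ x <= g x, x <= g y, y <= g x & y <= g y] ->
    exists z, [/\ x <= z, y <= z, z <= g x & z <= g y]
}.

Definition upset {d : Order.disp_t} (X : porderType d) (B : set X) : Prop :=
  forall x y, B x -> x <= y -> B y.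

(* [X] with the topology whose open sets are the upsets. *)
Definition upset_space {d : Order.disp_t} (X : porderType d) : Type := X.

Section UpsetSpace.
Context {d : Order.disp_t} (X : porderType d).

Let upsetT : upset [set: X].
Proof. by []. Qed.

Let upsetI : setI_closed (@upset d X).
Proof.
by move=> B C uB uC x y [Bx Cx] xy; split; [exact: uB xy|exact: uC xy].
Qed.

Let upset_bigU (I : Type) (f : I -> set X) :
  (forall i, upset (f i)) -> upset (\bigcup_i f i).
Proof. by move=> uf x y [i _ fix_] xy; exists i => //; exact: uf xy. Qed.

HB.instance Definition _ := Choice.copy (upset_space X) X.
HB.instance Definition _ :=
  isOpenTopological.Build (upset_space X) upsetT upsetI upset_bigU.

End UpsetSpace.

Section MonteiroAlgebra.
Context {d : Order.disp_t} (X : porderType d) (g : X -> X).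
Implicit Types B C : set X.

Definition monteiro_neg B : set X := [set x | ~ B (g x)].

Definition monteiro_imp B C : set X :=
  [set x | forall y, x <= y -> B y -> (monteiro_neg B `|` C)%classic y].

Definition monteiro_algebra : set_algebra (set X) := {|
  carrier := [set B | upset B];
  sjoin := setU;
  smeet := setI;
  simp := monteiro_imp;
  sneg := monteiro_neg;
  sbot := set0;
  stop := setT
|}.

End MonteiroAlgebra.

(* The completely join-irreducible elements with the order opposite to that
   of [A]. *)
Definition cji_space {d : Order.disp_t} (A : nelsonType d) : Type :=
  {j : A | j \in completely_join_irreducible A}.

Section CjiSpace.
Context {d : Order.disp_t} (A : nelsonType d).

HB.instance Definition _ := SubChoice.copy (cji_space A)
  {j : A | j \in completely_join_irreducible A}.

Let cji_le (x y : cji_space A) : bool := val y <= val x.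

Let cji_le_refl : reflexive cji_le.
Proof. by move=> x; exact: lexx. Qed.

Let cji_le_anti : antisymmetric cji_le.
Proof. by move=> x y yx; apply/val_inj/le_anti; rewrite andbC. Qed.

Let cji_le_trans : transitive cji_le.
Proof. by move=> y x z yx zy; exact: le_trans zy yx. Qed.

HB.instance Definition _ := Order.Le_isPOrder.Build
  (Order.dual_display d) (cji_space A) cji_le_refl cji_le_anti cji_le_trans.

End CjiSpace.

Definition is_cji_map {d : Order.disp_t} (A : nelsonType d)
    (g : cji_space A -> cji_space A) : Prop :=
  forall j, infimums [set x : A | ~~ (x <= nneg (val j))] (val (g j)).

(* Main.v *)
(* The open sets of an Alexandrov space, the upsets of a poset, and (by a
   characterization of rough sets) the algebra of rough sets of a quasiorder are
   complete rings of sets, hence algebraic lattices.  Conversely, in an algebraic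
   lattice every element is a meet of completely meet-irreducible ones; the
   antiautomorphism [nneg] turns these into completely join-irreducible ones,
   which are completely join-prime because algebraic distributive lattices are
   frames.  So a Nelson algebra on an algebraic lattice is the algebra of upsets
   of its Monteiro space, the interpolation axiom coming from (N5).  Finally,
   with [R x y] meaning [min (x, g x) <= min (y, g y)], an upset [B] corresponds
   to the rough set [(B n g B, B u g B)]. *)

Require Import Defs.
From HB Require Import structures.
From Corelib Require Import RelationClasses.
From mathcomp Require Import all_boot all_order.
From mathcomp Require Import mathcomp_extra boolp classical_sets functions.
From mathcomp Require Import cardinality topology.

Set Implicit Arguments.
Unset Strict Implicit.
Unset Printing Implicit Defensive.

Import Order.TTheory.
Local Open Scope order_scope.
Local Open Scope classical_set_scope.

(** * Complete rings of sets *)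

Section CompleteRing.
Context {d : Order.disp_t} (L : latticeType d) (W : Type) (e : L -> set W).
Hypothesis e_le : forall a b, (a <= b) <-> e a `<=` e b.
Hypothesis e_bigcup : forall S : set L, exists c, e c = \bigcup_(a in S) e a.
Hypothesis e_bigcap : forall S : set L, exists c, e c = \bigcap_(a in S) e a.

Let e_inj a b : e a = e b -> a = b.
Proof. by move=> ab; apply/le_anti/andP; split; apply/e_le; rewrite ab. Qed.

Let e_sub a b : a <= b -> e a `<=` e b.
Proof. by move/e_le. Qed.

Let sub_e a b : e a `<=` e b -> a <= b.
Proof. by move/e_le. Qed.

Let supremumsE S c : e c = \bigcup_(a in S) e a -> supremums S c.
Proof.
move=> cE; split=> [a Sa|b ub]; apply: sub_e; rewrite cE => x.
  by exists a.
by move=> [a Sa ax]; exact: e_sub (ub _ Sa) _ ax.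
Qed.

Let infimumsE S c : e c = \bigcap_(a in S) e a -> infimums S c.
Proof.
move=> cE; split=> [a Sa|b lb]; apply: sub_e; rewrite cE => x; first exact.
by move=> bx a Sa; exact: e_sub (lb _ Sa) _ bx.
Qed.

(* The compact elements used are the least members of the ring containing a
   given point. *)
Lemma complete_ring_algebraic : algebraic_lattice L.
Proof.
split=> [S|a].
  have [c cE] := e_bigcup S; have [c' c'E] := e_bigcap S.
  by split; [exists c; exact: supremumsE|exists c'; exact: infimumsE].
have [N NE] := choice (fun x => e_bigcap [set b | e b x]).
have Nx x : e (N x) x by rewrite NE => b.
have N_le x b : e b x -> N x <= b by move=> bx; apply/e_le => y; rewrite NE;
  exact.
have N_compact x : compact_element (N x).
  move=> S s supS Ns; have [c cE] := e_bigcup S.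
  have : e s x by exact: e_sub Ns _ (Nx x).
  have -> : s = c by exact: (is_subset1_supremums supS (supremumsE cE)).
  rewrite cE => -[b Sb bx]; exists [set b]; split=> [|_ ->//|].
    exact: finite_set1.
  by exists b; [rewrite supremums1|exact: N_le].
exists [set N x | x in e a]; first by move=> _ [x _ <-]; exact: N_compact.
apply: supremumsE; apply/seteqP; split=> [x ax|x [_ [y ay <-] Nyx]].
  by exists (N x) => //; exists x.
by exact: e_sub (N_le _ _ ay) _ Nyx.
Qed.

End CompleteRing.

(** Represents [B] inside the subsets of [W]: the carrier becomes a complete ring of sets, and the
    Nelson axioms are read with inclusion of images as the order. The lattice laws then come from
    sets, and the converse half of (N2) from [ring_negK]. *)
Record nelson_ring (T W : Type) (B : set_algebra T) (e : T -> set W) : Prop := {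
  ring_inj : injective e;
  ring_bigcup : forall F, F `<=` carrier B ->
    exists2 c, carrier B c & e c = \bigcup_(b in F) e b;
  ring_bigcap : forall F, F `<=` carrier B ->
    exists2 c, carrier B c & e c = \bigcap_(b in F) e b;
  ring_join : forall a b, e (sjoin B a b) = e a `|` e b;
  ring_meet : forall a b, e (smeet B a b) = e a `&` e b;
  ring_bot : e (sbot B) = set0;
  ring_top : e (stop B) = setT;
  ring_neg : forall a, carrier B a -> carrier B (sneg B a);
  ring_imp : forall a b, carrier B a -> carrier B b -> carrier B (simp B a b);
  ring_negK : forall a, carrier B a -> sneg B (sneg B a) = a;
  ring_neg_anti : forall a b, carrier B a -> carrier B b -> e a `<=` e b ->
    e (sneg B b) `<=` e (sneg B a);
  ring_kleene : forall a b, carrier B a -> carrier B b ->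
    e a `&` e (sneg B a) `<=` e b `|` e (sneg B b);
  ring_adj : forall a b c, carrier B a -> carrier B b -> carrier B c ->
    e a `&` e c `<=` e (sneg B a) `|` e b <-> e c `<=` e (simp B a b);
  ring_curry : forall a b c, carrier B a -> carrier B b -> carrier B c ->
    simp B (smeet B a b) c = simp B a (simp B b c)
}.

(** * Nelson algebras carried by rings of sets *)

Section NelsonRing.
Context (T : choiceType) (W : Type) (B : set_algebra T) (e : T -> set W).
Hypothesis Be : nelson_ring B e.

Let join_in a b : carrier B a -> carrier B b -> carrier B (sjoin B a b).
Proof.
move=> Ba Bb; have [|c Bc cE] := ring_bigcup Be (F := [set a; b]).
  by move=> _ [->|->].
suff -> : sjoin B a b = c by [].
by apply: (ring_inj Be); rewrite (ring_join Be) cE bigcup_setU !bigcup_set1.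
Qed.

Let meet_in a b : carrier B a -> carrier B b -> carrier B (smeet B a b).
Proof.
move=> Ba Bb; have [|c Bc cE] := ring_bigcap Be (F := [set a; b]).
  by move=> _ [->|->].
suff -> : smeet B a b = c by [].
by apply: (ring_inj Be); rewrite (ring_meet Be) cE bigcap_setU !bigcap_set1.
Qed.

Let bot_in : carrier B (sbot B).
Proof.
have [//|c Bc cE] := ring_bigcup Be (F := set0).
suff -> : sbot B = c by [].
by apply: (ring_inj Be); rewrite (ring_bot Be) cE bigcup_set0.
Qed.

Let top_in : carrier B (stop B).
Proof.
have [//|c Bc cE] := ring_bigcap Be (F := set0).
suff -> : stop B = c by [].
by apply: (ring_inj Be); rewrite (ring_top Be) cE bigcap_set0.
Qed.

(* The unused argument makes the instances below available only under the
   hypothesis [Be]. *)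
Definition ring_elt of nelson_ring B e : Type := {a : T | a \in carrier B}.
Local Notation E := (ring_elt Be).
HB.instance Definition _ := SubChoice.copy E {a : T | a \in carrier B}.

Let valE (x : E) : carrier B (val x).
Proof. exact/set_mem/valP. Qed.

Let mk a (Ba : carrier B a) : E := exist _ a (mem_set Ba).

Let ev (x : E) : set W := e (val x).

Let ev_inj : injective ev.
Proof. by move=> x y /(ring_inj Be)/val_inj. Qed.

Let le (x y : E) : bool := `[< ev x `<=` ev y >].
Let lt (x y : E) : bool := (y != x) && le x y.
Let join (x y : E) : E := mk (join_in (valE x) (valE y)).
Let meet (x y : E) : E := mk (meet_in (valE x) (valE y)).

Let evU x y : ev (join x y) = ev x `|` ev y.
Proof. exact: ring_join. Qed.

Let evI x y : ev (meet x y) = ev x `&` ev y.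
Proof. exact: ring_meet. Qed.

Let le_def x y : le x y = (meet x y == x).
Proof.
apply/asboolP/eqP => [xy|<-]; last by rewrite evI; exact: subIsetr.
by apply: ev_inj; rewrite evI; exact/setIidPl.
Qed.

Let meetC : commutative meet.
Proof. by move=> x y; apply: ev_inj; rewrite !evI setIC. Qed.
Let joinC : commutative join.
Proof. by move=> x y; apply: ev_inj; rewrite !evU setUC. Qed.
Let meetA : associative meet.
Proof. by move=> x y z; apply: ev_inj; rewrite !evI setIA. Qed.
Let joinA : associative join.
Proof. by move=> x y z; apply: ev_inj; rewrite !evU setUA. Qed.
Let joinKI y x : meet x (join x y) = x.
Proof. by apply: ev_inj; rewrite evI evU setUC setKU. Qed.
Let meetKU y x : join x (meet x y) = x.
Proof. by apply: ev_inj; rewrite evU evI setIC setKI. Qed.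
Let meetUl : left_distributive meet join.
Proof. by move=> x y z; apply: ev_inj; rewrite !(evI, evU) setIUl. Qed.
Let meetxx : idempotent_op meet.
Proof. by move=> x; apply: ev_inj; rewrite evI setIid. Qed.

HB.instance Definition _ := Order.isMeetJoinDistrLattice.Build
  Order.default_display E le_def (fun _ _ => erefl) meetC joinC meetA joinA
  joinKI meetKU meetUl meetxx.

Let le_ev (x y : E) : (x <= y) <-> ev x `<=` ev y.
Proof. by split=> /asboolP. Qed.

Let bot : E := mk bot_in.
Let top : E := mk top_in.

Let le_bot (x : E) : bot <= x.
Proof. by apply/le_ev; rewrite /ev /= (ring_bot Be). Qed.

Let le_top (x : E) : x <= top.
Proof. by apply/le_ev; rewrite /ev /= (ring_top Be). Qed.

HB.instance Definition _ := Order.hasBottom.Build _ E le_bot.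
HB.instance Definition _ := Order.hasTop.Build _ E le_top.

Let imp (x y : E) : E := mk (ring_imp Be (valE x) (valE y)).
Let neg (x : E) : E := mk (ring_neg Be (valE x)).

Let negK x : neg (neg x) = x.
Proof. exact/val_inj/(ring_negK Be)/valE. Qed.

Let neg_le (x y : E) : x <= y -> neg y <= neg x.
Proof. by move=> /le_ev xy;
apply/le_ev/(ring_neg_anti Be (valE x) (valE y) xy). Qed.

Let neg_anti (x y : E) : (x <= y) = (neg y <= neg x).
Proof. by apply/idP/idP => /neg_le//; rewrite !negK. Qed.

Let kleene (x y : E) : (x `&` neg x <= y `|` neg y)%O.
Proof.
by apply/le_ev; rewrite evI evU; apply: (ring_kleene Be); exact: valE.
Qed.

Let adj (x y z : E) : (x `&` z <= neg x `|` y)%O = (z <= imp x y).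
Proof.
have [xy yx] := ring_adj Be (valE x) (valE y) (valE z).
by apply/idP/idP => /le_ev; rewrite ?evI ?evU => h; apply/le_ev;
  rewrite ?evI ?evU; [exact: xy|exact: yx].
Qed.

Let curry (x y z : E) : imp (x `&` y)%O z = imp x (imp y z).
Proof. by apply/val_inj/(ring_curry Be); exact: valE. Qed.

HB.instance Definition _ :=
  TBDistrLattice_isNelson.Build _ E negK neg_anti kleene adj curry.

Lemma nelson_ring_algebraic : is_algebraic_nelson B.
Proof.
exists _, E; split.
  apply: (@complete_ring_algebraic _ _ _ ev) => [x y|S|S]; first exact: le_ev.
    have [_ [x _ <-]|c Bc cE] := ring_bigcup Be (F := val @` S);
      first exact: valE.
    by exists (mk Bc); rewrite /ev /= cE bigcup_image.
  have [_ [x _ <-]|c Bc cE] := ring_bigcap Be (F := val @` S);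
    first exact: valE.
  by exists (mk Bc); rewrite /ev /= cE bigcap_image.
exists val; split=> //; split=> [x _|x y _ _|a Ba]; first exact: valE.
  exact: val_inj.
by exists (mk Ba).
Qed.

End NelsonRing.

(** * Rough sets of a quasiorder *)

Section RoughSets.
Variables (U : Type) (R : U -> U -> Prop).
Hypothesis R_preorder : PreOrder R.

Let Rxx x : R x x.
Proof. by case: R_preorder. Qed.

Let Rtrans y x z : R x y -> R y z -> R x z.
Proof. by case: R_preorder => _; exact. Qed.

(** Partial colour classes: a point reaching one colour also reaches the other. *)
Definition mutually_cofinal (C D : set U) : Prop :=
  [/\ C `&` D = set0, forall x, C x -> exists2 y, R x y & D y
    & forall x, D x -> exists2 y, R x y & C y].

(* Either some point above [x] is only below equivalent points, and a
   two-element subset of its class does, or there is an infinite strictly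
   increasing sequence above [x], whose even and odd terms do. *)
Lemma mutually_cofinal_above x :
  (forall y, R x y -> exists2 z, R y z & z <> y) ->
  exists C D, [/\ mutually_cofinal C D, C !=set0, C `<=` R x & D `<=` R x].
Proof.
move=> nomax.
have [[y xy ymax]|nex] := pselect (exists2 y, R x y & forall z, R y z -> R z y).
  have [z yz zy] := nomax _ xy.
  exists [set y], [set z]; split; [split| | |].
  - by apply/seteqP; split=> // t [/= -> /esym].
  - by move=> _ ->; exists z.
  - by move=> _ ->; exists y => //; exact: ymax.
  - by exists y.
  - by move=> _ ->.
  - by move=> _ ->; exact: Rtrans xy yz.
have next (y : {y | R x y}) : exists z : {z | R x z},
    R (sval y) (sval z) /\ ~ R (sval z) (sval y).
  case: y => y xy /=; apply: contrapT => no; apply: nex; exists y => // z yz.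
  apply: contrapT => zy; apply: no.
  by exists (exist _ z (Rtrans xy yz)).
have [s sP] := choice next.
pose u n := sval (iter n s (exist _ x (Rxx x))).
have xu n : R x (u n) by exact: (svalP (iter n s _)).
have u_step n : R (u n) (u n.+1)
  by have [] := sP (iter n s (exist _ x (Rxx x))).
have u_strict n : ~ R (u n.+1) (u n).
  by have [] := sP (iter n s (exist _ x (Rxx x))).
have u_homo m n : (m <= n)%N -> R (u m) (u n).
  elim: n => [|n IHn]; first by rewrite leqn0 => /eqP ->.
  rewrite leq_eqVlt => /orP[/eqP ->//|]; rewrite ltnS => /IHn mn.
  exact: Rtrans mn (u_step n).
have u_lt m n : (m < n)%N -> u m <> u n.
  by move=> mn umn; apply: (u_strict m); rewrite umn; exact: u_homo.
have u_inj : injective u.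
  by move=> m n umn; case: (ltngtP m n) => // /u_lt; rewrite umn.
exists [set u n | n in [set n | odd n]], [set u n | n in [set n | ~~ odd n]].
split; [split| | |].
- apply/seteqP; split=> // t [[m /= om <-] [n /= en /u_inj nm]].
  by move: en; rewrite nm om.
- by move=> _ [n /= on <-]; exists (u n.+1) => //; exists n.+1 => //=;
    rewrite on.
- by move=> _ [n /= on <-]; exists (u n.+1) => //; exists n.+1.
- by exists (u 1); exists 1.
- by move=> _ [n _ <-].
- by move=> _ [n _ <-].
Qed.

(** Zorn's lemma yields a maximal mutually cofinal pair. Every point of [Q] reaches it, since
    otherwise [mutually_cofinal_above] would supply a pair to add. *)
Lemma cofinal_bipartition (Q : set U) :
  (forall x y, Q x -> R x y -> Q y) ->
  (forall x, Q x -> exists2 y, R x y & y <> x) ->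
  exists C, forall x, Q x ->
    (exists2 y, R x y & C y) /\ (exists2 y, R x y & ~ C y).
Proof.
move=> Qup Qsplit.
(* a pair [(C, D)] is coded as the set [C * {true} + D * {false}] *)
pose part (E : set (U * bool)) b : set U := [set x | E (x, b)].
have [F FP tot|E [[E0 Etrue Efalse] maxE]] := @Zorn_bigcup (U * bool)
    [set E | mutually_cofinal (part E true) (part E false)].
  split.
  - apply/seteqP; split=> // x [[E FE Ex] [E' FE' E'x]].
    have [EE'|E'E] := tot _ _ FE FE'.
      have [disj _ _] := FP _ FE'.
      suff: set0 x by []. by rewrite -disj; split=> //; exact: EE'.
    have [disj _ _] := FP _ FE.
    suff: set0 x by []. by rewrite -disj; split=> //; exact: E'E.
  - move=> x [E FE Ex]; have [_ /(_ _ Ex)[y xy Ey] _] := FP _ FE.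
    by exists y => //; exists E.
  - move=> x [E FE Ex]; have [_ _ /(_ _ Ex)[y xy Ey]] := FP _ FE.
    by exists y => //; exists E.
have disjE y : E (y, true) -> E (y, false) -> False.
  by move=> yt yf; suff: set0 y by []; rewrite -E0.
exists (part E true) => x Qx.
have [[y [xy [Ey|Ey]]]|noE] :=
    pselect (exists y, R x y /\ (E (y, true) \/ E (y, false))).
- split; first by exists y.
  have [z yz Ez] := Etrue _ Ey.
  by exists z; [exact: Rtrans xy yz|move=> /disjE; exact].
- split; last by exists y => // /disjE; exact.
  by have [z yz Ez] := Efalse _ Ey; exists z => //; exact: Rtrans xy yz.
have [y xy|C [D [[CD0 CD DC] [c Cc] Cx Dx]]] := @mutually_cofinal_above x.
  exact/Qsplit/Qup/xy.
(* [C] and [D] lie above [x], which reaches neither colour of [E], so adding them keeps the colours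
   disjoint. *)
exfalso; apply: (maxE (E `|` [set p | if p.2 then C p.1 else D p.1])).
  split=> [p Ep|]; first by left.
  move=> /(_ (c, true)) Ec; apply: noE; exists c; split; first exact: Cx.
  by left; apply: Ec; right.
split.
- apply/seteqP; split=> // y [[Ey|Cy] [Ey'|Dy]].
  + exact: disjE Ey'.
  + by apply: noE; exists y; split; [exact: Dx|left].
  + by apply: noE; exists y; split; [exact: Cx|right].
  + by rewrite -CD0.
- move=> y [/Etrue[z yz Ez]|/CD[z yz Dz]]; exists z => //; [by left|by right].
- move=> y [/Efalse[z yz Ez]|/DC[z yz Cz]]; exists z => //; [by left|by right].
Qed.

(** Describes rough sets without the underlying set [X], so that closure under the operations
    becomes a pointwise check. The last condition is forced because both approximations agree at a
    point whose only successor is itself. *)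
Lemma rough_setsP (p : set U * set U) :
  rough_sets R p <->
  [/\ forall x y, p.1 x -> R x y -> p.1 y, forall x y, p.2 y -> R x y -> p.2 x,
      p.1 `<=` p.2
    & forall x, (forall y, R x y -> y = x) -> p.2 x -> p.1 x].
Proof.
split=> [[X _ <-]/=|].
  split=> [x y xX xy z yz|x y [z [yz Xz]] xy|x xX|x xmax [y [/xmax -> Xx]]].
  - exact: xX (Rtrans xy yz).
  - by exists z; split=> //; exact: Rtrans xy yz.
  - by exists x; split; [exact: Rxx|exact/xX/Rxx].
  - by move=> z /xmax ->.
case: p => A B /= [Aup Bdown AB maxA].
pose Q := [set x | R x `<=` B `\` A].
have [x y xQ xy z yz|x xQ|C CP] := @cofinal_bipartition Q.
- exact: xQ (Rtrans xy yz).
(* A point of [Q] whose only successor is itself would be in [A] by [maxA]. *)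
- apply: contrapT => no; have [Bx nAx] := xQ _ (Rxx x).
  apply/nAx/maxA => // y xy; apply: contrapT => yx; apply: no.
  by exists y.
(* [C] splits [Q] so that each of its points reaches both this set and its complement. Points of [B]
   with a successor outside [B] may all be included: the set stays inside [B], so they never enter
   the lower approximation. *)
exists (A `|` (Q `&` C) `|` [set x | B x /\ ~ (R x `<=` B)]) => //.
have XB : A `|` (Q `&` C) `|` [set x | B x /\ ~ (R x `<=` B)] `<=` B.
  by move=> x [[/AB//|[/(_ _ (Rxx x))[]//]]|[]].
congr pair; apply/seteqP; split=> x.
- move=> xX; have xB : R x `<=` B by move=> y /xX/XB.
  have [[//|[Qx _]]|[_ /(_ xB)//]] := xX _ (Rxx x).
  have [_ [y xy nCy]] := CP _ Qx; have [_ nAy] := Qx _ xy.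
  have [[//|[_ //]]|[_ []]] := xX _ xy.
  by move=> z yz; exact/xB/Rtrans/yz.
- by move=> Ax y xy; left; left; exact: Aup xy.
- by move=> [y [xy /XB By]]; exact: Bdown By xy.
- move=> Bx; have [xB|xB] := pselect (R x `<=` B); last first.
    by exists x; split; [exact: Rxx|right].
  have [[y xy Ay]|noA] := pselect (exists2 y, R x y & A y).
    by exists y; split=> //; left; left.
  have Qx : Q x by move=> y xy; split; [exact: xB|move=> Ay; apply: noA;
    exists y].
  have [[y xy Cy] _] := CP _ Qx; exists y; split=> //; left; right; split=> //.
  by move=> z yz; exact/Qx/Rtrans/yz.
Qed.

(** Turns coordinatewise inclusion of pairs into inclusion of subsets of a single set, as
    [nelson_ring] requires. *)
Definition disjoint_sum (p : set U * set U) : set (U + U) :=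
  [set x | match x with inl y => p.1 y | inr y => p.2 y end].

Lemma disjoint_sum_sub p q :
  disjoint_sum p `<=` disjoint_sum q <-> p.1 `<=` q.1 /\ p.2 `<=` q.2.
Proof.
split=> [pq|[pq1 pq2] [x|x]]; [|exact: pq1|exact: pq2].
by split=> x; [exact: (pq (inl x))|exact: (pq (inr x))].
Qed.

Lemma rough_nelson_ring : nelson_ring (rough_set_algebra R) disjoint_sum.
Proof.
split=> /=.
- move=> [A B] [C D] /seteqP[/disjoint_sum_sub[/= AC BD] /disjoint_sum_sub[/=
    CA DB]].
  by congr pair; exact/seteqP.
- move=> F FR; exists (\bigcup_(p in F) p.1, \bigcup_(p in F) p.2).
    apply/rough_setsP; split=> /= [x y|x y|x|x xmax] [p Fp px];
      have /rough_setsP[up down sub sing] := FR _ Fp; exists p => //.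
    + by move: px => /up; exact.
    + by move: px => /down; exact.
    + exact: sub.
    + exact: sing.
  by apply/seteqP; split=> -[x|x].
- move=> F FR; exists (\bigcap_(p in F) p.1, \bigcap_(p in F) p.2).
    apply/rough_setsP; split=> /= [x y px xy|x y px xy|x px|x xmax px] p Fp;
      have /rough_setsP[up down sub sing] := FR _ Fp.
    + exact: up (px _ Fp) xy.
    + exact: down (px _ Fp) xy.
    + exact/sub/px.
    + exact/sing/px.
  by apply/seteqP; split=> -[x|x].
- by move=> p q; apply/seteqP; split=> -[x|x].
- by move=> p q; apply/seteqP; split=> -[x|x].
- by apply/seteqP; split=> -[x|x].
- by apply/seteqP; split=> -[x|x].
- move=> [A B] /rough_setsP[/= Aup Bdown AB sing]; apply/rough_setsP.
  split=> /= [x y nBx xy By|x y nAy xy Ax|x nBx /AB//|x xmax nAx /(sing _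
    xmax)//].
    exact: nBx (Bdown _ _ By xy).
  exact: nAy (Aup _ _ Ax xy).
- move=> [A B] [C D] /rough_setsP[/= Aup Bdown AB singA].
  move=> /rough_setsP[/= Cup Ddown CD singC]; apply/rough_setsP.
  split=> /= [x y xX xy z yz|x y|x /(_ _ (Rxx x))|x xmax].
  + exact: xX (Rtrans xy yz).
  + move=> [nAy|Dy] xy; [left=> Ax|right; exact: Ddown Dy xy].
    exact: nAy (Aup _ _ Ax xy).
  + by move=> [nAx|/CD Dx]; [left|right].
  + by move=> [nAx|Dx] y /xmax ->; [left|right; exact: singC].
- by move=> [A B] _; rewrite /= !setCK.
- move=> [A B] [C D] _ _ /disjoint_sum_sub[/= AC BD].
  by apply/disjoint_sum_sub; split=> x /=; exact: contra_not (_ x).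
- move=> [A B] [C D] /rough_setsP[/= _ _ AB _] /rough_setsP[/= _ _ CD _].
  move=> [x [/= /AB Bx []//]|x _ /=].
  by have [/CD Dx|nCx] := pselect (C x); [left|right].
- move=> [A B] [C D] [E F] /rough_setsP[/= Aup _ AB _] _ /rough_setsP[/= Eup
    _ _ _].
  split=> [sub [x /= Ex y xy|x /= Fx]|sub [x [/= Ax Ex]|x [/= Bx Fx]]].
  + have [Ay|nAy] := pselect (A y); [right|by left].
    by have [/(_ (AB _ Ay))|] := sub (inl y) (conj Ay (Eup _ _ Ex xy)).
  + have [Ax|nAx] := pselect (A x); [right|by left].
    by have [/(_ Ax)|] := sub (inr x) (conj (AB _ Ax) Fx).
  + by have [nAx|Cx] := sub (inl x) Ex x (Rxx x); [|right].
  + exact: (sub (inr x)).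
- move=> [A B] [C D] [E F] /rough_setsP[/= Aup _ _ _] _ _ /=.
  congr pair; last by rewrite setCI setUA.
  apply/seteqP; split=> x xX y xy.
    have [Ay|nAy] := pselect (A y); [right|by left].
    move=> z yz; have [nACz|Ez] := xX z (Rtrans xy yz); last by right.
    by left=> Cz; apply: nACz; split=> //; exact: Aup Ay yz.
  have [nAy|] := xX y xy; first by left=> -[].
  by move=> /(_ y (Rxx y)) [nCy|Ey]; [left=> -[]|right].
Qed.

End RoughSets.

(** * Upsets of a Monteiro space *)

Section Monteiro.
Context {d : Order.disp_t} (X : porderType d) (g : X -> X).
Hypothesis gM : monteiro g.

Let gK x : g (g x) = x.
Proof. exact: (monteiroK gM). Qed.

Let g_anti x y : x <= y -> g y <= g x.
Proof. exact: (monteiro_anti gM). Qed.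

Let g_swap x y : x <= g y -> y <= g x.
Proof. by move=> /g_anti; rewrite gK. Qed.

Let upset_neg (B : set X) : upset B -> upset (monteiro_neg g B).
Proof. by move=> uB x y nBx /g_anti yx /uB /(_ yx). Qed.

Let upset_imp (B C : set X) : upset (monteiro_imp g B C).
Proof. by move=> x y xBC xy z yz; apply/xBC/(le_trans xy). Qed.

(** In the hard inclusion, [y <= z] with [y], [g y] in [B] and [z], [g z] in [C]; it suffices to
    find [u] between [y] and [z] such that [u] and [g u] are in both [B] and [C]. *)
Lemma monteiro_curry (B C D : set X) : upset B -> upset C -> upset D ->
  monteiro_imp g (B `&` C) D = monteiro_imp g B (monteiro_imp g C D).
Proof.
move=> uB uC uD; apply/seteqP; split=> x xI y xy; last first.
  move=> [By Cy]; have [nBy|/(_ y (lexx y) Cy)[nCy|Dy]] := xI y xy By.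
  - by left=> -[].
  - by left=> -[].
  - by right.
move=> By; have [Bgy|nBgy] := pselect (B (g y)); [right|by left].
move=> z yz Cz; have [Cgz|nCgz] := pselect (C (g z)); [right|by left].
have gzy := g_anti yz.
have in_D u : y <= u -> C u -> B (g u) -> C (g u) -> D u.
  move=> yu Cu Bgu Cgu; have [|nBC|//] := xI u (le_trans xy yu).
    by split=> //; exact: uB By yu.
  by case: nBC.
have [ygy|gyy] := monteiro_cmp gM y; last first.
  apply: uD yz; apply: in_D => //; last exact: uC Cgz gzy.
  by apply: uC Cgz _; exact: le_trans gyy.
have [zgz|gzz] := monteiro_cmp gM z.
  by apply: in_D => //; apply: uB By _; exact: le_trans zgz.
(* When [g y <= y] or [z <= g z], the point [y] or [z] itself served. In the remaining case (J4) for
   [y] and [g z] gives [u]. *)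
have [|u [yu gzu ugy uz]] := monteiro_interp gM (x := y) (y := g z).
  by rewrite gK.
rewrite gK in uz; apply: (uD _ _ _ uz); apply: in_D => //.
- exact: uC Cgz gzu.
- exact/(uB _ _ By)/g_swap.
- exact/(uC _ _ Cgz)/g_anti.
Qed.

Lemma monteiro_nelson_ring : nelson_ring (monteiro_algebra g) id.
Proof.
split=> //=.
- move=> F uF; exists (\bigcup_(B in F) B) => // x y [B FB Bx] xy.
  by exists B => //; exact: uF FB _ _ Bx xy.
- move=> F uF; exists (\bigcap_(B in F) B) => // x y Bx xy B FB.
  exact: uF FB _ _ (Bx _ FB) xy.
- by move=> B _; apply/funext => x; rewrite /monteiro_neg /= gK notK.
- by move=> B C _ _ BC x nCx /BC.
- move=> B C uB uC x [Bx nBx].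
  have [Cgx|nCgx] := pselect (C (g x)); [left|by right].
  have [xgx|gxx] := monteiro_cmp gM x; first by case: nBx; exact: uB xgx.
  exact: uC gxx.
- move=> B C D uB uC uD; split=> [sub x Dx y xy By|sub x [Bx Dx]].
    by apply: sub; split=> //; exact: uD xy.
  exact: sub Dx x (lexx x) Bx.
- exact: monteiro_curry.
Qed.

End Monteiro.

(** * The T0 Alexandrov topology of upsets *)

Section UpsetTopology.
Context {d : Order.disp_t} (X : porderType d).

Lemma open_upset : open = @upset d X :> set (set (upset_space X)).
Proof. by []. Qed.

Lemma upset_space_kolmogorov : kolmogorov_space (upset_space X).
Proof.
have open_up x : open ([set y | x <= y] : set (upset_space X)).
  by rewrite open_upset => y z /= xy yz; exact: le_trans yz.
move=> x y xy; have [lexy|nlexy] := boolP ((x : X) <= y).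
  exists [set z | (y : X) <= z]; right; split; apply/mem_set.
    by apply: open_nbhs_nbhs; split=> /=; [exact: open_up|exact: lexx].
  by move=> /= yx; case/eqP: xy; apply/le_anti; rewrite lexy.
exists [set z | (x : X) <= z]; left; split; apply/mem_set; last exact/negP.
by apply: open_nbhs_nbhs; split=> /=; [exact: open_up|exact: lexx].
Qed.

Lemma upset_space_alexandrov : alexandrov_space (upset_space X).
Proof.
move=> F oF; rewrite open_upset => x y Fx xy B FB.
by have := oF _ FB; rewrite open_upset; apply; [exact: Fx|].
Qed.

End UpsetTopology.

(** * Completely join-irreducible elements of an algebraic Nelson lattice *)

Section FiniteBounds.
Context {d : Order.disp_t}.

Lemma compact_finite_join (L : bLatticeType d) (c s : L) (S : set L) :
  compact_element c -> supremums S s -> c <= s ->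
  exists2 r : seq L, {in r, forall x, S x} & c <= \join_(x <- r) x.
Proof.
move=> cptc supS cs; have [F [/finite_seqP[r ->] FS [t [_ tmin] ct]]] :=
  cptc _ _ supS cs.
exists r => [x xr|]; first exact: FS.
by apply: le_trans ct (tmin _ _) => x /= xr; exact: joins_sup_seq.
Qed.

Lemma chain_join (L : bLatticeType d) (r : seq L) (K : set L) :
  (forall x y, K x -> K y -> x <= y \/ y <= x) -> K !=set0 ->
  {in r, forall x, K x} -> exists2 k, K k & \join_(x <- r) x <= k.
Proof.
move=> chain [k0 Kk0]; elim: r => [|x r IHr] rK.
  by exists k0; rewrite // big_nil le0x.
have [y yr|k Kk rk] := IHr; first by apply: rK; rewrite inE yr orbT.
have Kx : K x by apply: rK; exact: mem_head.
have [xk|kx] := chain _ _ Kx Kk; [exists k|exists x] => //;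
  rewrite big_cons leUx.
  by rewrite xk.
by rewrite lexx (le_trans rk).
Qed.

Lemma meet_joins_le (L : bDistrLatticeType d) (x u : L) (r : seq L) :
  {in r, forall y, Order.meet x y <= u} -> Order.meet x (\join_(y <- r) y) <= u.
Proof.
elim: r => [|y r IHr] ru; first by rewrite big_nil meetx0 le0x.
rewrite big_cons meetUr leUx ru ?mem_head //=; apply: IHr => z zr.
by apply: ru; rewrite inE zr orbT.
Qed.

(** Infinite distributivity reduces to the finite case: a compact element below the meet of [x] and
    [s] is below a finite join from [S]. *)
Lemma algebraic_frame (L : bDistrLatticeType d) (x s u : L) (S : set L) :
  algebraic_lattice L -> supremums S s ->
  (forall y, S y -> Order.meet x y <= u) -> Order.meet x s <= u.
Proof.
move=> [_ algL] supS Su; have [K Kcpt [Kub Kmin]] := algL (Order.meet x s).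
apply: Kmin => c Kc; have := Kub _ Kc; rewrite lexI => /andP[cx cs].
have [r rS cr] := compact_finite_join (Kcpt _ Kc) supS cs.
apply: (@le_trans _ _ (Order.meet x (\join_(y <- r) y)));
  first by rewrite lexI cx.
by apply: meet_joins_le => y /rS/Su.
Qed.

(** By [algebraic_frame], [j] is the join of its meets with members of [S], so irreducibility makes
    one of these meets equal to [j]. *)
Lemma cji_prime (L : bDistrLatticeType d) (j s : L) (S : set L) :
  algebraic_lattice L -> completely_join_irreducible L j ->
  supremums S s -> j <= s -> exists2 x, S x & j <= x.
Proof.
move=> algL cjij supS js.
have [|x Sx <-] := cjij [set Order.meet j x | x in S]; last first.
  by exists x => //; exact: leIr.
split=> [_ [x Sx <-]|u ub]; first exact: leIl.
have := algebraic_frame (x := j) (u := u) algL supS.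
rewrite (meet_idPl js); apply => y Sy; apply: ub.
by exists y.
Qed.

(** Zorn's lemma applies since, by compactness, the join of a chain avoiding [c] still avoids it.
    Such an [m] is completely meet-irreducible. *)
Lemma maximal_avoiding_compact (L : bLatticeType d) (a c : L) :
  algebraic_lattice L -> compact_element c -> ~~ (c <= a) ->
  exists m, [/\ a <= m, ~~ (c <= m) & forall y, m < y -> c <= y].
Proof.
move=> [complete _] cptc nca.
pose P := {m : L | (a <= m) && ~~ (c <= m)}.
have [//|u v w|u v uv vu|K totK|m mmax] :=
    @Zorn P (fun u v => val u <= val v).
- exact: le_trans.
- by apply/val_inj/le_anti; rewrite uv.
- have [[k Kk]|noK] := pselect (K !=set0); last first.
    exists (exist _ a (introT andP (conj (lexx a) nca))) => s Ks.
    by case: noK; exists s.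
  have [[t supt] _] := complete (val @` K).
  have ub s : K s -> val s <= t by move=> Ks; apply: supt.1; exists s.
  have nct : ~~ (c <= t).
    apply/negP => /(compact_finite_join cptc supt)[r rK cr].
    have [||_ [k' _ <-] rk'] := chain_join _ _ rK.
    - by move=> _ _ [x Kx <-] [y Ky <-]; have := totK _ _ Kx Ky.
    - by exists (val k); exists k.
    by have /andP[_ /negP] := valP k'; apply; exact: le_trans rk'.
  have at_ : a <= t by have /andP[ak _] := valP k; exact: le_trans ak (ub _ Kk).
  by exists (exist _ t (introT andP (conj at_ nct))).
have /andP[am ncm] := valP m.
exists (val m); split=> // y my; apply: contraT => ncy.
have ay : a <= y by exact: le_trans am (ltW my).
have ym := mmax (exist _ y (introT andP (conj ay ncy))) (ltW my).
by rewrite -ym ltxx in my.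
Qed.

End FiniteBounds.

(** * The Monteiro space of a Nelson algebra *)

Section NelsonAlgebra.
Context {d : Order.disp_t} (A : nelsonType d).
Hypothesis algA : algebraic_lattice A.

Lemma nneg_swap (a b : A) : (nneg a <= b) = (nneg b <= a).
Proof. by rewrite nneg_anti nnegK. Qed.

Lemma nneg_swapr (a b : A) : (a <= nneg b) = (b <= nneg a).
Proof. by rewrite nneg_anti nnegK. Qed.

(** Some compact [c] is below [nneg b] but not below [nneg a]. An [m] maximal among the elements
    above [nneg a] and not above [c] is meet-irreducible, and its negation is the required [j]. *)
Lemma cji_dense (a b : A) : ~~ (a <= b) ->
  exists j, [/\ completely_join_irreducible A j, j <= a & ~~ (j <= b)].
Proof.
rewrite nneg_anti => nab; have [_ alg] := algA.
have [K Kcpt [Kub Kmin]] := alg (nneg b).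
have [c Kc nca] : exists2 c, K c & ~~ (c <= nneg a).
  apply: contrapT => no; move/negP: nab; apply; apply: Kmin => c Kc.
  by apply: contraT => nca; case: no; exists c.
have [m [am ncm mmax]] := maximal_avoiding_compact algA (Kcpt _ Kc) nca.
exists (nneg m); split.
(* If [nneg m] were not in [S], each [nneg s] would lie strictly above [m], hence above [c], which
   would put [c] below [m]. *)
- move=> S supS; apply: contrapT => nSm; move/negP: ncm; apply.
  rewrite nneg_anti; apply: supS.2 => s Ss; rewrite nneg_swapr; apply: mmax.
  rewrite lt_neqAle nneg_swapr supS.1// andbT; apply/eqP => ms.
  by apply: nSm; rewrite ms nnegK.
- by rewrite nneg_swap.
- rewrite nneg_swap; apply/negP => bm; move/negP: ncm; apply.
  exact: le_trans (Kub _ Kc) bm.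
Qed.

Lemma cji_le_join (j a b : A) : completely_join_irreducible A j ->
  (j <= Order.join a b) = (j <= a) || (j <= b).
Proof.
move=> cjij; apply/idP/orP => [|[]]; [|exact: lexUl|exact: lexUr].
have supab : supremums [set a; b] (Order.join a b).
  split=> [_ [->|->]|u ub]; [exact: leUl|exact: leUr|rewrite leUx].
  by rewrite !ub//; [right|left].
by move=> /(cji_prime algA cjij supab)[_ [->|->]]; [left|right].
Qed.

(** The infimum [k] is itself not below [nneg j], hence the least such element; it is irreducible
    since a join of elements below [nneg j] stays below [nneg j]. *)
Lemma cji_mapP (j : A) : completely_join_irreducible A j ->
  exists2 k, completely_join_irreducible A k &
    infimums [set x | ~~ (x <= nneg j)] k /\
    forall x, (k <= x) = ~~ (x <= nneg j).
Proof.
move=> cjij; have [_ [k infk]] := algA.1 [set x | ~~ (x <= nneg j)].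
have kE x : (k <= x) = ~~ (x <= nneg j).
  apply/idP/idP => [kx|/infk.1//]; apply/negP => xj.
  (* Were [k] below [nneg j], then [j] would be below this join [nneg k], hence by primeness below
     one of the joined elements, which their choice excludes. *)
  have supS : supremums [set y | ~~ (nneg y <= nneg j)] (nneg k).
    split=> [y /= ny|u ub]; first by rewrite nneg_swapr; exact: infk.1.
    rewrite nneg_swap; apply: infk.2 => y /= ny; rewrite nneg_swap.
    by apply: ub; rewrite /= nnegK.
  have jk : j <= nneg k by rewrite nneg_swapr; exact: le_trans xj.
  have [y /= /negP ny jy] := cji_prime algA cjij supS jk.
  by apply: ny; rewrite -nneg_anti.
exists k => // S supS.
have := lexx k; rewrite kE => nkj.
have [s Ss ksj] : exists2 s, S s & ~~ (s <= nneg j).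
  apply: contrapT => no; move/negP: nkj; apply; apply: supS.2 => s Ss.
  by apply: contraT => nsj; case: no; exists s.
suff -> : k = s by [].
by apply/le_anti; rewrite kE ksj supS.1.
Qed.


Local Notation J := (cji_space A).

Lemma le_cji (x y : J) : (x <= y) = (val y <= val x).
Proof. by []. Qed.

Lemma valJ (j : J) : completely_join_irreducible A (val j).
Proof. exact/set_mem/valP. Qed.

Lemma cji_map_exists : exists2 g : J -> J, is_cji_map g &
  forall j x, (val (g j) <= x) = ~~ (x <= nneg (val j)).
Proof.
have /choice[g gP] (j : J) : exists k : J,
    infimums [set x | ~~ (x <= nneg (val j))] (val k) /\
    forall x, (val k <= x) = ~~ (x <= nneg (val j)).
  have [k kJ kP] := cji_mapP (@valJ j).
  by exists (exist _ k (mem_set kJ)).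
by exists g => [j|j x]; have [] := gP j.
Qed.

Section CjiMap.
Variable g : J -> J.
Hypothesis gE : forall j x, (val (g j) <= x) = ~~ (x <= nneg (val j)).

Lemma cji_monteiro : monteiro g.
Proof.
have gK (x : J) (a : A) : (val (g (g x)) <= a) = (val x <= a).
  by rewrite gE nneg_swapr gE negbK -nneg_anti.
split.
- move=> x y; rewrite !le_cji gE => yx.
  have := lexx (val (g y)); rewrite gE; apply: contra => /le_trans; apply.
  by rewrite -nneg_anti.
- by move=> x; apply/val_inj/le_anti; rewrite gK lexx -gK lexx.
(* (J3) is the Kleene inequality for [x] and [g x], split by primeness. *)
- move=> x; rewrite !le_cji gE.
  have [xnx|] := boolP (val x <= nneg (val x)); [right|by left].
  have := nneg_kleene (val x) (val (g x)).
  rewrite (meet_idPl xnx) cji_le_join; last exact: valJ.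
  case/orP => //; rewrite nneg_swapr => gx.
  by have := lexx (val (g x)); rewrite gE gx.
- move=> x y; rewrite !le_cji !gE => -[nxx nxy nyx nyy].
  (* An irreducible separating the meet of [x] and [y] from the join of their negations is the
     interpolant of (J4). *)
  have [xy|/cji_dense[z [zJ]]] :=
      boolP (Order.meet (val x) (val y) <= Order.join (nneg (val x)) (nneg
        (val y)));
    last first.
    rewrite lexI cji_le_join// negb_or => /andP[zx zy] /andP[zgx zgy].
    by exists (exist _ z (mem_set zJ)); rewrite !le_cji !gE.
  (* Without a separating irreducible, (N5) and primeness put [x] below [nimp y \bot]; then [g y],
     being below both [x] and [y], would be below [nneg y]. *)
  have : \top <= nimp (Order.meet (val x) (val y)) \bot.
    rewrite -nimp_adj meetx1 joinx0; apply: le_trans xy _.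
    by rewrite leUx -!nneg_anti leIl leIr.
  rewrite nimp_curry -nimp_adj meetx1 cji_le_join; last exact: valJ.
  rewrite (negbTE nxx) /= -nimp_adj joinx0 => yx.
  have : val (g y) <= Order.meet (val y) (val x) by rewrite lexI !gE nyy.
  by move=> /le_trans/(_ yx); rewrite gE lexx.
Qed.

Definition cji_below (a : A) : set J := [set j | val j <= a].

Lemma cji_below_sub (a b : A) : cji_below a `<=` cji_below b -> a <= b.
Proof.
move=> ab; apply: contraT => /cji_dense[j [jJ ja /negP jb]].
by case: jb; exact: (ab (exist _ j (mem_set jJ))).
Qed.

Lemma cji_below_neg (a : A) (j : J) :
  val j <= nneg a <-> monteiro_neg g (cji_below a) j.
Proof.
by rewrite /monteiro_neg /cji_below /= gE nneg_swapr; split=> [->//|/negP];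
  rewrite negbK.
Qed.

(** Density gives injectivity; primeness gives surjectivity and compatibility with joins. *)
Lemma cji_below_iso : nelson_iso (monteiro_algebra g) cji_below.
Proof.
split=> /=.
- split=> [a _ x y /= xa|a b _ _ ab|B uB].
  + by rewrite le_cji => yx; exact: le_trans yx xa.
  + by apply/le_anti/andP; split; apply: cji_below_sub; rewrite ab.
  (* The preimage of an upset is the join of its members; by primeness no further irreducible lies
     below it. *)
  + have [[s sups] _] := algA.1 [set val j | j in B].
    exists s => //; apply/seteqP; split=> j; last by move=> Bj;
      apply: sups.1; exists j.
    move=> /(cji_prime algA (@valJ j) sups)[_ [k Bk <-]] jk.
    exact: uB Bk jk.
- move=> a b; apply/seteqP; split=> j /=.
    by rewrite /cji_below /= cji_le_join; [case/orP; [left|right]|exact: valJ].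
  by rewrite /cji_below /= => jab; rewrite cji_le_join; [exact/orP|exact: valJ].
- move=> a b; apply/seteqP; split=> j; rewrite /cji_below /= lexI;
    first by case/andP.
  by move=> [-> ->].
- move=> a b; apply/seteqP; split=> j; rewrite -/(cji_below _) /=.
    rewrite /cji_below /= -nimp_adj => abj k kj ka.
    have kaj : val k <= Order.meet a (val j) by rewrite lexI ka.
    have := le_trans kaj abj; rewrite cji_le_join; last exact: valJ.
    by case/orP; [move/cji_below_neg; left|right].
  (* By (N4) the claim is an inequality in [A], which can be tested on irreducibles. *)
  move=> jI; rewrite /cji_below /= -nimp_adj; apply: cji_below_sub => k.
  rewrite /cji_below /= lexI => /andP[ka kj].
  rewrite cji_le_join; last exact: valJ.
  by apply/orP; have [/cji_below_neg|] := jI k kj ka; [left|right].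
- by move=> a; apply/seteqP; split=> j /cji_below_neg.
- apply/seteqP; split=> // j; rewrite /cji_below /= => j0.
  have [|_ []] := cji_prime algA (@valJ j) (S := set0) (s := \bot) _ j0.
  by split=> // u _; exact: le0x.
- by apply/seteqP; split=> // j _; exact: lex1.
Qed.

End CjiMap.
End NelsonAlgebra.

(* By (N4) the implication of a Nelson algebra is determined by its lattice
   structure and its negation. *)
Lemma nelson_ring_iso {d : Order.disp_t} (A : nelsonType d) (T W : Type)
    (B : set_algebra T) (e : T -> set W) (f : A -> T) :
  nelson_ring B e -> set_bij [set: A] (carrier B) f ->
  (forall a b, f (Order.join a b) = sjoin B (f a) (f b)) ->
  (forall a b, f (Order.meet a b) = smeet B (f a) (f b)) ->
  (forall a, f (nneg a) = sneg B (f a)) ->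
  f \bot = sbot B -> f \top = stop B -> nelson_iso B f.
Proof.
move=> Be [fB finj fsurj] fU fI fN f0 f1.
have f_in a : carrier B (f a) by exact: fB.
have f_inj : injective f by move=> a b ab; apply: finj; rewrite ?inE.
have f_le a b : a <= b <-> e (f a) `<=` e (f b).
  rewrite leEmeet; split=> [/eqP <-|/setIidPl].
    by rewrite fI (ring_meet Be); exact: subIsetr.
  by rewrite -(ring_meet Be) -fI => /(ring_inj Be)/f_inj ->.
split=> // a b.
have [c _ cE] := fsurj _ (ring_imp Be (f_in a) (f_in b)).
have adj x : (x <= c) = (x <= nimp a b).
  have fadj := ring_adj Be (f_in a) (f_in b) (f_in x).
  rewrite -nimp_adj; apply/idP/idP => [/f_le|/f_le].
    by rewrite cE => /fadj.2 xab; apply/f_le;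
      rewrite fI fU fN (ring_meet Be) (ring_join Be).
  by rewrite fI fU fN (ring_meet Be) (ring_join Be) => /fadj.1;
    rewrite -cE => /f_le.
by rewrite -cE; congr f; apply/le_anti; rewrite adj lexx -adj lexx.
Qed.

(** * From Monteiro spaces to rough sets *)

Section MonteiroRough.
Context {d : Order.disp_t} (X : porderType d) (g : X -> X).
Hypothesis gM : monteiro g.

Let gK x : g (g x) = x.
Proof. exact: (monteiroK gM). Qed.

Let g_anti x y : x <= y -> g y <= g x.
Proof. exact: (monteiro_anti gM). Qed.

Definition lower x : X := if x <= g x then x else g x.

Lemma lower_le x : lower x <= g (lower x).
Proof.
rewrite /lower; case: ifPn => // nx; rewrite gK.
by have [xg|//] := monteiro_cmp gM x; rewrite xg in nx.
Qed.

Lemma lower_id x : x <= g x -> lower x = x.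
Proof. by rewrite /lower => ->. Qed.

Lemma lower_idem x : lower (lower x) = lower x.
Proof. exact/lower_id/lower_le. Qed.

Lemma lower_g x : lower (g x) = lower x.
Proof.
rewrite /lower gK; case: ifPn; case: ifPn => //.
  by move=> xg gx; apply/le_anti; rewrite xg gx.
by move=> /negPf xg /negPf gx; have [] := monteiro_cmp gM x; rewrite ?xg ?gx.
Qed.

Lemma le_lower x y : x <= y -> x <= g y -> x <= lower y.
Proof. by rewrite /lower; case: ifP. Qed.

Definition lower_rel x y : Prop := lower x <= lower y.

Lemma lower_rel_preorder : PreOrder lower_rel.
Proof. by split=> [x|x y z]; [exact: lexx|exact: le_trans]. Qed.

(** [x] is always related to [g x], as both have the same [lower]. Conversely a fixed point of [g]
    is maximal among the values of [lower], since [g] reverses the order. *)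
Lemma lower_rel_max x :
  (forall y, lower_rel x y -> y = x) <-> g x = x.
Proof.
split=> [xmax|gx y]; first by apply: xmax; rewrite /lower_rel lower_g lexx.
have lx : lower x = x by apply: lower_id; rewrite gx lexx.
rewrite /lower_rel lx => xy.
have yx : lower y <= x.
  by have := g_anti xy; rewrite gx; exact: le_trans (lower_le y).
have ly : lower y = x by apply/le_anti; rewrite xy yx.
by move: ly; rewrite /lower; case: ifP => // _ gy; rewrite -[y]gK gy.
Qed.

(** [lower x] and [g (lower x)] are the smaller and the larger of [x] and [g x], so for an upset [B]
    these are the intersection and the union of [B] with its image under [g]. *)
Definition rough_of_upset (B : set X) : set X * set X :=
  ([set x | B (lower x)], [set x | B (g (lower x))]).

Lemma rough_of_upset_in (B : set X) :
  upset B -> rough_sets lower_rel (rough_of_upset B).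
Proof.
move=> uB; apply/rough_setsP; first exact: lower_rel_preorder.
split=> /= [x y Bx xy|x y By xy|x Bx|x /lower_rel_max gx].
- exact: uB Bx xy.
- exact/(uB _ _ By)/g_anti.
- exact: uB Bx (lower_le x).
- by rewrite /lower gx lexx gx.
Qed.

(** Each [x] is [lower x] or [g (lower x)], so the two coordinates determine membership in [B]. *)
Lemma rough_of_upset_inj : injective rough_of_upset.
Proof.
move=> B C /(congr1 (fun p => (p.1, p.2))) [BC1 BC2]; apply/funext => x.
have := congr1 (@^~ x) BC1; have := congr1 (@^~ x) BC2.
by rewrite /= /lower; case: ifP => // _; rewrite gK.
Qed.

Lemma rough_of_upset_surj (p : set X * set X) : rough_sets lower_rel p ->
  exists2 B, upset B & rough_of_upset B = p.
Proof.
case: p => P Q /(rough_setsP lower_rel_preorder)[/= Pup Qdown PQ sing].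
exists [set x | if x <= g x then P x else Q x].
  move=> x y /=; case: ifPn => [xg Px xy|nxg Qx xy]; case: ifPn => [yg|nyg].
  - by apply: Pup Px _; rewrite /lower_rel !lower_id.
  - have gyy : g y <= y.
      by have [yg|//] := monteiro_cmp gM y; rewrite yg in nyg.
    have [|z [xz gyz zgx zy]] := monteiro_interp gM (x := x) (y := g y).
      by rewrite gK; split=> //; exact: g_anti.
    rewrite gK in zy.
    have xz' : x <= g z by rewrite -[x]gK; exact: g_anti.
    apply: (@Qdown y z); last first.
      by rewrite /lower_rel [lower y]/lower (negbTE nyg) le_lower ?g_anti.
    by apply/PQ/(Pup _ _ Px); rewrite /lower_rel lower_id ?le_lower.
  - move/negP: nxg; case; rewrite (le_trans xy)// (le_trans yg)//.
    exact: g_anti.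
  - apply: Qdown Qx _; rewrite /lower_rel /lower (negbTE nxg) (negbTE nyg).
    exact: g_anti.
have Plower x : P (lower x) <-> P x.
  by split=> Px; apply: Pup Px _; rewrite /lower_rel lower_idem lexx.
have Qlower x : Q (g (lower x)) <-> Q x.
  by split=> Qx; apply: Qdown Qx _; rewrite /lower_rel lower_g lower_idem lexx.
congr pair; apply/funext => x; apply/propext => /=.
  by rewrite lower_le Plower.
(* Here [g] fixes [lower x], and at fixed points [PQ] and [sing] make [P] and [Q] agree. *)
case: ifPn => [wg|_]; last exact: Qlower.
have gl : g (lower x) = lower x.
  by apply/le_anti; rewrite lower_le andbT -{2}[lower x]gK.
rewrite -(Qlower x) gl; split; [exact: PQ|apply: sing; exact/lower_rel_max].
Qed.

(** [nelson_ring_iso] spares a direct comparison of the two implications. *)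
Lemma isomorphic_rough {d' : Order.disp_t} (A : nelsonType d') :
  isomorphic A (monteiro_algebra g) ->
  isomorphic A (rough_set_algebra lower_rel).
Proof.
move=> [f [[fB finj fsurj] fU fI _ fN f0 f1]].
exists (rough_of_upset \o f).
apply: (nelson_ring_iso (rough_nelson_ring lower_rel_preorder)) => /=.
- split=> [a _|a b aT bT /rough_of_upset_inj|p].
  + exact/rough_of_upset_in/fB.
  + exact: finj.
  + move=> /rough_of_upset_surj[B /fsurj[a _ <-] <-].
    by exists a.
- by move=> a b; rewrite fU.
- by move=> a b; rewrite fI.
- move=> a; rewrite fN; congr pair; apply/funext => x.
  by rewrite /= /monteiro_neg /= gK.
- by rewrite f0.
- by rewrite f1.
Qed.

End MonteiroRough.

(** * Passage between rough sets, Nelson algebras, T0 Alexandrov topologies and Monteiro spaces *)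

Theorem theorem3p2 :
  (* (i) -> (ii) *)
  (forall (U : Type) (R : U -> U -> Prop), PreOrder R ->
     is_algebraic_nelson (rough_set_algebra R))
  /\
  (* (ii) -> (i) *)
  (forall (d : Order.disp_t) (A : nelsonType d), algebraic_lattice A ->
     exists (U : Type) (R : U -> U -> Prop),
       PreOrder R /\ isomorphic A (rough_set_algebra R))
  /\
  (* (iii) -> (ii) *)
  (forall (X : topologicalType)
     (imp : set X -> set X -> set X) (neg : set X -> set X),
     kolmogorov_space X -> alexandrov_space X ->
     is_nelson (open_algebra imp neg) ->
     is_algebraic_nelson (open_algebra imp neg))
  /\
  (* (ii) -> (iii) *)
  (forall (d : Order.disp_t) (A : nelsonType d), algebraic_lattice A ->
     exists (X : topologicalType)
       (imp : set X -> set X -> set X) (neg : set X -> set X),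
       kolmogorov_space X /\ alexandrov_space X /\
       isomorphic A (open_algebra imp neg))
  /\
  (* (iv) -> (ii), on the T0 Alexandrov topology of upsets *)
  (forall (d : Order.disp_t) (X : porderType d) (g : X -> X), monteiro g ->
     kolmogorov_space (upset_space X) /\ alexandrov_space (upset_space X) /\
     carrier (monteiro_algebra g) = (open : set (set (upset_space X))) /\
     is_algebraic_nelson (monteiro_algebra g))
  /\
  (* (ii) -> (iv) *)
  (forall (d : Order.disp_t) (A : nelsonType d), algebraic_lattice A ->
     exists g : cji_space A -> cji_space A,
       is_cji_map g /\ monteiro g /\ isomorphic A (monteiro_algebra g)).
Proof.
(* All three representations of [A] pass through its Monteiro space. *)
have mon (d : Order.disp_t) (A : nelsonType d) : algebraic_lattice A ->
    exists g : cji_space A -> cji_space A,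
      is_cji_map g /\ monteiro g /\ isomorphic A (monteiro_algebra g).
  move=> algA; have [g g_inf gE] := cji_map_exists algA.
  exists g; split=> //; split; first exact: cji_monteiro gE.
  by exists (@cji_below _ A); exact: cji_below_iso gE.
split; [|split; [|split; [|split; [|split]]]].
- move=> U R preR; exact: nelson_ring_algebraic (rough_nelson_ring preR).
- move=> d A /mon[g [_ [gM isoA]]].
  exists (cji_space A), (lower_rel g); split; first exact: lower_rel_preorder.
  exact: isomorphic_rough isoA.
- move=> X imp neg _ alexX [d [A isoA]]; exists d, A; split=> //.
  have [f [[fB finj fsurj] fU fI _ _ _ _]] := isoA.
  have f_open a : open (f a) by exact: fB.
  (* The open sets of an Alexandrov space form a complete ring of sets, in which [f] represents
     [A]. *)
  apply: (@complete_ring_algebraic _ _ _ f) => [a b|S|S].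
  + rewrite leEmeet; split=> [/eqP <-|/setIidPl fab].
      by rewrite fI; exact: subIsetr.
    by apply/eqP/finj; rewrite ?inE// fI.
  + have [|a _ aE] := fsurj (\bigcup_(a in S) f a); last by exists a.
    by apply: bigcup_open => a _; exact: f_open.
  + have [|a _ aE] := fsurj (\bigcap_(a in S) f a); last by exists a.
    by rewrite -(bigcap_image S f id); apply: alexX => _ [a _ <-];
      exact: f_open.
- move=> d A /mon[g [_ [_ isoA]]].
  exists (upset_space (cji_space A)), (monteiro_imp g), (monteiro_neg g).
  split; [exact: upset_space_kolmogorov|split;
    [exact: upset_space_alexandrov|]].
  exact: isoA.
- move=> d X g gM; split; first exact: upset_space_kolmogorov.
  split; first exact: upset_space_alexandrov.
  by split=> //; exact: nelson_ring_algebraic (monteiro_nelson_ring gM).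
- exact: mon.
Qed.
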